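(* Let $G=(V,E^+,E^-)$ be a signed graph with $n=|V|$ vertices and maximum degree $\Delta$, let $\beta\in(0,1]$, and let $s\in V$. Run the algorithm $\mathtt{Search}(G,\beta,s,p,T)$ described in the context. Suppose that its while-loop repeats for a total of $t$ iterations, and let $h$ be the size of $S$ when the algorithm returns. Then, with high probability, $h=\Omega(t/\log n)$, and the running time of the algorithm is $O(\Delta\, t\log n)$ in expectation (i.e. the expected running time is $O(\Delta\log n\cdot\mathbb{E}[t])$).
   Context: A signed graph is a finite undirected simple graph $G=(V,E^+,E^-)$ whose edge set is partitioned into positive edges $E^+$ and negative edges $E^-$. $N(x)$ denotes the set of neighbours of $x$, and $G[S]$ the subgraph induced by a vertex set $S$. For a coloring $\mathcal{X}=(x_i)_{i\in V}\in\{0,1\}^V$ and $\beta\in(0,1]$, the Tolerant Balance Count is $$\hat\Phi(G,\beta,\mathcal{X})=|E^+\cup E^-|-\frac1\beta\sum_{(i,j)\in E^+}\mathbf 1\{x_i\ne x_j\}-\frac1\beta\sum_{(i,j)\in E^-}\mathbf 1\{x_i=x_j\}.$$ Algorithm $\mathtt{Search}(G,\beta,s,p,T)$, with $p\in(0,1)$, $T$ a positive integer and $s\in V$. It maintains a set $S$ of colored vertices (pairs $(x,c)$, $x\in V$, $c\in\{0,1\}$, each vertex occurring at most once; $|S|$ is the number of its vertices). The value of $S$ is $\hat\Phi$ of the subgraph induced by the vertices of $S$ with the coloring stored in $S$. The gain of an operation is the change it causes in this value. The operations are: VertexInsert$(x,c)$ (add $(x,c)$ to $S$, for $x\notin S$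 adjacent to $S$), VertexDelete$(x)$ (remove $x$ from $S$, the remaining induced subgraph being required to stay connected), ColorFlip$(x)$ (replace the color of $x\in S$ by the opposite one). Initially $S=\{(s,0)\}$, $\hat\Phi_{opt}=\hat\Phi_{cur}=0$, and a counter $\tau=T$. Two max-heaps keyed by gain are maintained: $MH_I$ holding all insertions $(v,c)$ with $v\notin S$ adjacent to $S$ and $c\in\{0,1\}$, and $MH_F$ holding the color flips of all vertices of $S$. While $\tau\ge 0$ and $|S|<|V|$, do one iteration: 1. let $op$ be the maximum-gain operation of $MH_I$; 2. with probability $p$, replace $op$ by the top operation of $MH_F$ if the latter has larger gain; 3. independently, with probability $\frac{p\log|S|}{|S|}$, call $\mathtt{DelEval}(S)$, which finds the maximum-gain deletion among vertices of $S$ whose removal keeps the subgraph connected (in time $O(\Delta|S|)$ using Tarjan's cut-vertex algorithm), and replace $op$ by it if it has larger gain; 4. execute $op$ on $S$, and for $x$ the vertex of $op$ update the entries of all $v\in N(x)\cup\{x\}$ in both heaps (each heap update costs $O(\log n)$); add the gain of $op$ to $\hat\Phi_{cur}$; 5. if $\hat\Phi_{cur}\le\hat\Phi_{opt}$, set $\tau\leftarrow\tau-1$; otherwise set $\hat\Phi_{opt}\leftarrow\hat\Phi_{cur}$ and $\tau\leftarrow\tau+T$. After the loop, the operations executed since the last update of $\hat\Phi_{opt}$ are undone, and $\overline H=G[S]$ and $\hat\Phi_{opt}$ are returned. Conventions: $p$ and $T$ are fixed constants, and constants hidden in $O(\cdot),\Omega(\cdot)$ may depend on them. ''With high probability'' means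 with probability at least $1-n^{-c}$ for any fixed constant $c>0$ (hidden constants may depend on $c$). Running time is counted in the standard unit-cost model. *)

(* Defs.v *)
From HB Require Import structures.
From mathcomp Require Import all_boot all_order all_algebra.
From mathcomp Require Import all_classical all_reals all_analysis.

Set Implicit Arguments.
Unset Strict Implicit.
Unset Printing Implicit Defensive.

Import Order.TTheory GRing.Theory Num.Theory.

Local Open Scope ring_scope.

Record sgraph (V : finType) := SGraph {
  epos : rel V;
  eneg : rel V;
  epos_sym : symmetric epos;
  eneg_sym : symmetric eneg;
  epos_irr : irreflexive epos;
  eneg_irr : irreflexive eneg;
  epos_eneg : forall x y, ~~ (epos x y && eneg x y) }.

Section Graph.
Context (R : realType) (V : finType) (G : sgraph V).

Definition adj : rel V := fun x y => epos G x y || eneg G x y.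

Definition nbrs (x : V) : {set V} := [set y | adj x y].

Definition max_degree : nat := \max_(x : V) #|nbrs x|.

(* The empty set is not connected. *)
Definition connected_in (A : {set V}) : bool :=
  (A != finset.set0) &&
  [forall x in A, forall y in A,
     connect (fun u v => [&& u \in A, v \in A & adj u v]) x y].

(* The Tolerant Balance Count of G[A] with the colouring x (only the values of
   x on A matter).  The sums range over ordered pairs, so they count every
   edge twice; hence the factor 1/2. *)
Definition tbc (beta : R) (A : {set V}) (x : V -> bool) : R :=
  2^-1 * (\sum_(i in A) \sum_(j in A) (adj i j)%:R
          - beta^-1 * \sum_(i in A) \sum_(j in A | epos G i j) (x i != x j)%:R
          - beta^-1 * \sum_(i in A) \sum_(j in A | eneg G i j) (x i == x j)%:R).

End Graph.

(* The set S of coloured vertices: [S x = Some c] when (x, c) is in S, and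
   [S x = None] when x is not a vertex of S; the colours 0 and 1 are [false]
   and [true]. *)
Definition colset (V : finType) := {ffun V -> option bool}.

Inductive op (V : finType) :=
  | VertexInsert of V & bool
  | VertexDelete of V
  | ColorFlip of V.
Arguments VertexInsert {V}.
Arguments VertexDelete {V}.
Arguments ColorFlip {V}.

Definition op_code (V : finType) (o : op V) : V * (bool + bool) :=
  match o with
  | VertexInsert x c => (x, inl c)
  | VertexDelete x => (x, inr false)
  | ColorFlip x => (x, inr true)
  end.

Definition op_decode (V : finType) (a : V * (bool + bool)) : op V :=
  match a with
  | (x, inl c) => VertexInsert x c
  | (x, inr false) => VertexDelete x
  | (x, inr true) => ColorFlip x
  end.

Lemma op_codeK (V : finType) : cancel (@op_code V) (@op_decode V).
Proof. by case. Qed.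

HB.instance Definition _ (V : finType) :=
  Finite.copy (op V) (can_type (@op_codeK V)).

Section Operations.
Context (R : realType) (V : finType) (G : sgraph V) (beta : R).
Implicit Types (S : colset V) (o : op V).

Definition verts S : {set V} := [set x | S x != None].

Definition value S : R := tbc G beta (verts S) (fun x => S x == Some true).

Definition op_vertex o : V :=
  match o with
  | VertexInsert x _ => x
  | VertexDelete x => x
  | ColorFlip x => x
  end.

Definition exec o S : colset V :=
  [ffun y => if y == op_vertex o then
               match o with
               | VertexInsert _ c => Some c
               | VertexDelete _ => None
               | ColorFlip _ => omap negb (S y)
               end
             else S y].

Definition gain S o : R := value (exec o S) - value S.

Definition insertions S : {set op V} :=
  [set o | if o is VertexInsert x _ then
             (x \notin verts S) && [exists y in verts S, adj G x y]
           else false].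

Definition flips S : {set op V} :=
  [set o | if o is ColorFlip x then x \in verts S else false].

Definition deletions S : {set op V} :=
  [set o | if o is VertexDelete x then
             (x \in verts S) && connected_in G (verts S :\ x)
           else false].

Definition max_gain S (A : {set op V}) : {set op V} :=
  [set o in A | [forall o' in A, gain S o' <= gain S o]].

End Operations.

(* Which of several operations of equal maximal gain is selected is left to an
   arbitrary rule, which may depend on the whole history of S (as the layout of
   a heap does). *)
Definition tie_rule (V : finType) := seq (colset V) -> {set op V} -> op V.

Definition valid_tie_rule (V : finType) (tb : tie_rule V) : Prop :=
  forall (hist : seq (colset V)) (A : {set op V}),
    A != finset.set0 -> tb hist A \in A.

(* [undoable] is the number of operations executed since the last update of
   [phi_opt], [past] the list of the earlier values of [cur], most recent
   first, and [time] the cost of the iterations performed so far. *)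
Record config (R : realType) (V : finType) := Config {
  cur : colset V;
  past : seq (colset V);
  phi_cur : R;
  phi_opt : R;
  tau : int;
  undoable : nat;
  time : R;
  stuck : bool }.

Section Search.
Context (R : realType) (V : finType) (G : sgraph V) (beta : R) (s : V).
Context (T : nat) (K : R) (tb : tie_rule V).
Implicit Types (x : config R V) (b : bool * bool).

(* K bounds all the constants hidden in the costs of the elementary steps. *)

Let logn : R := ln #|V|%:R.

Definition start : colset V := [ffun y => if y == s then Some false else None].

Definition init : config R V :=
  {| cur := start; past := [::]; phi_cur := 0; phi_opt := 0; tau := T%:Z;
     undoable := 0; time := K * (1 + #|s |: nbrs G s|%:R * logn);
     stuck := false |}.

Definition running x : bool :=
  [&& ~~ stuck x, (0 <= tau x)%R & (#|verts (cur x)| < #|V|)%N].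

Definition top x (A : {set op V}) : option (op V) :=
  if A == finset.set0 then None
  else Some (tb (cur x :: past x) (max_gain G beta (cur x) A)).

Definition improve x (o : op V) (o' : option (op V)) : op V :=
  if o' is Some o1 then
    if gain G beta (cur x) o < gain G beta (cur x) o1 then o1 else o
  else o.

(* The coin [b.1] decides whether the top of MH_F is considered, [b.2] whether
   DelEval is called.  The result is [None] when MH_I is empty. *)
Definition select x b : option (op V) :=
  if top x (insertions G (cur x)) is Some o then
    let o1 := if b.1 then improve x o (top x (flips (cur x))) else o in
    let o2 := if b.2 then improve x o1 (top x (deletions G (cur x))) else o1 in
    Some o2
  else None.

(* O(1) for the bookkeeping, O(Delta |S|) for DelEval when it is called, and
   O(log n) for the (at most three) heap entries of each v in N(x) + {x}. *)
Definition iter_cost x b (o : op V) : R :=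
  K * (1 + (if b.2 then (max_degree G * #|verts (cur x)|)%:R else 0)
         + #|op_vertex o |: nbrs G (op_vertex o)|%:R * logn).

(* When MH_I is empty (S is a whole component of a disconnected G) the
   iteration has no operation to start from: the loop is left. *)
Definition iterate b x : config R V :=
  if ~~ running x then x else
  if select x b is Some o then
    let phi := phi_cur x + gain G beta (cur x) o in
    let better := phi_opt x < phi in
    {| cur := exec o (cur x);
       past := cur x :: past x;
       phi_cur := phi;
       phi_opt := if better then phi else phi_opt x;
       tau := if better then tau x + T%:Z else tau x - 1;
       undoable := if better then 0%N else (undoable x).+1;
       time := time x + iter_cost x b o;
       stuck := false |}
  else
    {| cur := cur x; past := past x; phi_cur := phi_cur x;
       phi_opt := phi_opt x; tau := tau x; undoable := undoable x;
       time := time x + K; stuck := true |}.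

(* [run w k] is the configuration after k iterations (or at the end of the
   loop, if it has fewer), [w i] being the coins of iteration i. *)
Fixpoint run (w : nat -> bool * bool) (k : nat) : config R V :=
  if k is k'.+1 then iterate (w k') (run w k') else init.

Let rank (a : R) := #|[set S : colset V | a < value G beta S]|.

Let value_start : value G beta start = 0.
Proof.
have E y : (y \in verts start) = (y == s).
  by rewrite inE ffunE; case: (y == s).
have e0 : adj G s s = false by rewrite /adj epos_irr eneg_irr.
have sum1 (F : V -> R) : \sum_(i in verts start) F i = F s.
  by apply: big_pred1.
rewrite /value /tbc !sum1 e0 !big1 ?mulr0 ?subr0 ?mulr0 //.
  by move=> j /andP[]; rewrite E => /eqP ->; rewrite eneg_irr.
by move=> j /andP[]; rewrite E => /eqP ->; rewrite epos_irr.
Qed.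

Let run_value w k : phi_cur (run w k) = value G beta (cur (run w k)).
Proof.
elim: k => [|k IH] /=; first by rewrite value_start.
rewrite /iterate; case: ifP => // _; case: (select _ _) => [a|] //=.
by rewrite IH /gain addrC subrK.
Qed.

(* The loop always terminates. *)
Lemma run_halts (w : nat -> bool * bool) : exists k, ~~ running (run w k).
Proof.
suff H m j k : (rank (phi_opt (run w k)) < m)%N -> tau (run w k) < j%:Z ->
    exists k', ~~ running (run w k').
  apply: (H (rank 0).+1 T.+1 0%N) => //.
  by rewrite /= ltz_nat ltnSn.
elim: m j k => [//|m IHm]; elim=> [|j IHj] k hm hj.
  by exists k; rewrite /running leNgt hj andbF.
have [r|] := boolP (running (run w k)); last by exists k.
have v := run_value w k.+1.
have e : run w k.+1 = iterate (w k) (run w k) by [].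
move: (run w k.+1) v e (IHm^~ k.+1) (IHj k.+1) (ex_intro (fun i =>
  ~~ running (run w i)) k.+1) => y v e {}IHm {}IHj stop.
move: e; rewrite /iterate r /=; case: (select _ _) => [a|] e; last first.
  by apply: stop; rewrite e.
case: ltP e => [lt|_] e.
  apply: (IHm `|tau y|.+1); last by rewrite intS ltz1D lez_abs.
  rewrite ltnS in hm; apply: leq_trans hm.
  apply: proper_card; apply/properP; split.
    by apply/fintype.subsetP => S; rewrite !inE e /=; apply: lt_trans.
  exists (cur y); rewrite !inE -v e //=.
  by rewrite ltxx.
apply: IHj; rewrite e //=.
by rewrite ltrBlDr -[1]/(1%:Z) -PoszD addn1.
Qed.

(* The number t of iterations of the loop. *)
Definition iterations (w : nat -> bool * bool) : nat := ex_minn (run_halts w).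

Definition final w : config R V := run w (iterations w).

(* S once the operations executed since the last update of phi_opt are undone. *)
Definition returned w : colset V :=
  nth (cur (final w)) (cur (final w) :: past (final w)) (undoable (final w)).

Definition returned_size w : nat := #|verts (returned w)|.

(* Initialization and iterations, then the undo phase (each undone operation is
   charged as the heap updates of an executed one) and the output of G[S]. *)
Definition running_time w : R :=
  time (final w)
  + K * ((undoable (final w))%:R * (1 + (max_degree G).+1%:R * logn)
         + ((max_degree G).+1 * returned_size w)%:R).

(* Probability of the coins b in an iteration which starts from x. *)
Definition coins_pr (p : R) x b : R :=
  let m : R := #|verts (cur x)|%:R in
  bernoulli_pmf p b.1 * bernoulli_pmf (p * ln m / m) b.2.

(* The coins are those of the algorithm: given the coins of the earlier
   iterations, those of iteration i are independent with the prescribed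
   parameters.  Coins of rounds after the end of the loop are not used. *)
Definition search_coins (p : R) d (Omega : measurableType d)
    (P : probability Omega R) (cF cD : nat -> {RV P >-> bool}) : Prop :=
  forall (w : nat -> bool * bool) (N : nat),
    P [set omega | forall i, (i < N)%N -> (cF i omega, cD i omega) = w i]%classic
    = (\prod_(i < N) coins_pr p (run w i) (w i))%:E.

End Search.

(* Main.v *)
(* An iteration inserts a vertex unless one of its coins says otherwise, and it
   deletes one only if DelEval is called, which at size m has probability
   p ln m / m, and this vanishes as m grows.  Hence |S| drifts upwards once it
   is large, and for a suitable decreasing phi and rho < 1 the process
   phi(|S|) / rho^k is a supermartingale; by Markov's inequality, |S_k| < k / D
   has probability exponentially small in k.  A union bound over k >= A ln n
   leaves probability n^-c.  Since tau loses 1 in each iteration that does not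
   improve phi_opt and gains T in each one that does, t is at most
   (T + 2)(k + 1), where k is the time of the last improvement, and the set
   returned is S_k.

   For the cost, DelEval takes Delta |S| with probability p ln|S| / |S|, so the
   time minus O(Delta ln n) per iteration is a supermartingale as well.  The
   initialization, the undo phase and the output cost O(Delta t ln n). *)
Require Import Defs.
From HB Require Import structures.
From mathcomp Require Import all_boot all_order all_algebra.
From mathcomp Require Import all_classical all_reals all_analysis.
From mathcomp Require Import measurable_realfun.
From mathcomp Require Import ring lra zify.

Set Implicit Arguments.
Unset Strict Implicit.
Unset Printing Implicit Defensive.

Import Order.TTheory GRing.Theory Num.Theory.

Local Open Scope classical_set_scope.
Local Open Scope ring_scope.

(** * A potential for a walk with drift *)

Lemma ln_div_ge0 (R : realType) (m : nat) : 0 <= ln m%:R / m%:R :> R.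
Proof.
case: m => [|m]; first by rewrite invr0 mulr0.
by rewrite divr_ge0 // ln_ge0 // ler1n.
Qed.

Lemma ln_div_le1 (R : realType) (m : nat) : ln m%:R / m%:R <= 1 :> R.
Proof.
case: m => [|m]; first by rewrite invr0 mulr0.
by rewrite ler_pdivrMr ?ltr0Sn // mul1r ltW // ln_sublinear // ltr0Sn.
Qed.

(** The bound exp y >= 1 + y^2/2 at y = ln m gives (ln m)^2 <= 2m, so ln m > e m would force m <
    2/e^2. *)
Lemma ln_div_vanishes (R : realType) (e : R) : 0 < e ->
  exists m0 : nat, forall m : nat, (m0 <= m)%N -> ln m%:R / m%:R <= e.
Proof.
move=> e0; pose m0 := (Num.Def.archi_bound (2 / e ^+ 2)).
have m0P : 2 / e ^+ 2 < m0%:R.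
  by apply: archi_boundP; rewrite divr_ge0 // exprn_ge0 // ltW.
exists m0 => -[|m] mm; first by rewrite invr0 mulr0 ltW.
have xge : 2 / e ^+ 2 < m.+1%:R.
  by apply: lt_le_trans m0P _; rewrite ler_nat.
have x0 : 0 < m.+1%:R :> R by rewrite ltr0Sn.
have l0 : 0 <= ln m.+1%:R :> R by rewrite ln_ge0 // ler1n.
rewrite ler_pdivrMr //; move: (m.+1%:R : R) x0 xge l0 => x x0 xge l0.
have := expR_ge1Dxn 1 l0; rewrite lnK ?posrE // (_ : 2`! = 2)%N // => sq.
have {}sq : ln x ^+ 2 <= 2 * x by lra.
rewrite ltr_pdivrMr ?exprn_gt0 // in xge.
rewrite leNgt; apply/negP => lt.
have : (e * x) ^+ 2 < ln x ^+ 2 by rewrite ltr_pXn2r ?nnegrE // mulr_ge0 // ltW.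
have : 2 * x <= (e * x) ^+ 2.
  by rewrite exprMn mulrC [_ * x ^+ 2]mulrC expr2 -mulrA ler_wpM2l ?ltW // mulrC.
lra.
Qed.

Section Drift.
Variables (R : realType) (p : R).
Hypothesis p01 : 0 < p < 1.

(* Far out (m >= m0) the walk on |S| drifts upwards and 2^-m contracts in mean;
   below m0, where for p close to 1 the drift may be downwards, the potential
   is instead so concave that one step up outweighs any step down. *)
Lemma drift_potential : exists (phi : nat -> R) (rho : R),
  [/\ 0 < rho < 1, forall m, 2^-1 ^+ m <= phi m <= 2,
      forall m, phi m.+1 <= phi m
    & forall m, let u := p * ln m%:R / m%:R in
      (1 - p) * (1 - u) * phi m.+1 + p * (1 - u) * phi m + u * phi m.-1
      <= rho * phi m].
Proof.
have [p0 p1] := andP p01.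
(* [q] is a lower bound for the weight (1-p)(1-u) of a step up, since u <= p; [e] serves both as the
   bound on u far out and as the ratio of the powers used below [m0]. *)
pose q := (1 - p) ^+ 2; pose e := q / 4.
have q0 : 0 < q < 1 by rewrite exprn_gt0 ?subr_gt0 //= exprn_ilt1 //; lra.
have qE : q = (1 - p) ^+ 2 by [].
clearbody q.
have e0 : 0 < e < 4^-1 by rewrite /e; lra.
have [m0 m0P] := @ln_div_vanishes R e (proj1 (andP e0)).
have em (k : nat) : 0 < e ^+ k <= 1.
  by rewrite exprn_gt0 ?exprn_ile1 //; lra.
(* Truncated subtraction glues two branches: 2 - e^(m0-m) below [m0], and 2^-(m-m0) from [m0] on. *)
pose phi m : R := 2^-1 ^+ (m - m0) + 1 - e ^+ (m0 - m).
have hm (k : nat) : 0 < (2^-1 : R) ^+ k <= 1.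
  by rewrite exprn_gt0 ?exprn_ile1 //; lra.
have phiS m : phi m.+1 <= phi m.
  rewrite /phi; have [mm|mm] := leqP m0 m.
    have [z1 z2] : (m0 - m.+1 = 0 /\ m0 - m = 0)%N by clear -mm; lia.
    rewrite z1 z2.
    rewrite subSn // exprS; have := hm (m - m0)%N; lra.
  have [z1 z2] : (m.+1 - m0 = 0 /\ m - m0 = 0)%N by clear -mm; lia.
  rewrite z1 z2.
  rewrite (_ : m0 - m = (m0 - m.+1).+1)%N; last by clear -mm; lia.
  rewrite exprS; have := em (m0 - m.+1)%N; nra.
have phiB m : 2^-1 ^+ m <= phi m <= 2.
  have := em (m0 - m)%N; have := hm (m - m0)%N; rewrite /phi => ? ?.
  apply/andP; split; last lra.
  have : (2^-1 : R) ^+ m <= 2^-1 ^+ (m - m0).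
    by apply: ler_wiXn2l; [lra|lra|rewrite leq_subr].
  lra.
(* 1 - rho is a relative decrease that both branches guarantee. *)
pose rho := 1 - q / 8 * e ^+ m0.
exists phi, rho; split => //.
  by have := em m0; rewrite /rho; nra.
move=> m; cbv zeta; set u := p * ln _ / _.
have u01 : 0 <= u <= p.
  have := ln_div_ge0 R m; have := ln_div_le1 R m.
  by rewrite /u -mulrA => ? ?; nra.
have uS : (m0 <= m)%N -> u <= e.
  by move=> /m0P; rewrite /u -mulrA; have := ln_div_ge0 R m; nra.
have u00 : m = 0%N -> u = 0 by rewrite /u => ->; rewrite invr0 mulr0.
(* Since (1-p)(1-u) >= q, it remains to weigh the gain of a step up against the loss of a step
   down. *)
suff H : q / 8 * e ^+ m0 * phi m <=
    q * (phi m - phi m.+1) - u * (phi m.-1 - phi m).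
  have := phiS m; rewrite /rho.
  have qu : q <= (1 - p) * (1 - u) by rewrite qE expr2; apply: ler_wpM2l; lra.
  nra.
have := em m0; have := phiB m => /andP[_ phi2] em0.
clearbody u; clear phiB phiS.
(* Below [m0] a step down loses only e times what a step up gains, so u <= 1 is good enough against
   q = 4e. At m = 0 the predecessor is 0 itself and nothing is lost. *)
have [mm|mm] := ltnP m m0.
  have -> : phi m - phi m.+1 = (1 - e) * e ^+ (m0 - m.+1).
    have [z1 z2] : (m.+1 - m0 = 0 /\ m - m0 = 0)%N by clear -mm; lia.
    rewrite /phi z1 z2.
    rewrite (_ : m0 - m = (m0 - m.+1).+1)%N; last by clear -mm; lia.
    rewrite exprS; ring.
  have le1 : e ^+ m0 <= e ^+ (m0 - m.+1).
    by apply: ler_wiXn2l; [lra|lra|rewrite leq_subr].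
  have : u * (phi m.-1 - phi m) <= e * ((1 - e) * e ^+ (m0 - m.+1)).
    case: m mm u00 {phi2 u01 uS} (u01) le1 => [|m] mm u00 u01 le1 /=.
      by rewrite subrr mulr0; have := em (m0 - 1)%N; rewrite !mulr_ge0 //; lra.
    have [z1 z2] : (m.+1 - m0 = 0 /\ m - m0 = 0)%N by clear -mm; lia.
    rewrite /phi z1 z2.
    rewrite (_ : m0 - m = (m0 - m.+2).+2)%N; last by clear -mm; lia.
    rewrite (_ : m0 - m.+1 = (m0 - m.+2).+1)%N; last by clear -mm; lia.
    rewrite !exprS; have := em (m0 - m.+2)%N; move: (e ^+ _) => y y01.
    have : 0 <= e * ((1 - e) * y) by rewrite !mulr_ge0 //; lra.
    nra.
  have eq : q = 4 * e by rewrite /e; lra.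
  rewrite eq; move: (e ^+ (m0 - m.+1)) le1 => z le1 le2.
  have : 4 * e / 8 * e ^+ m0 * phi m <= e * e ^+ m0.
    rewrite -(subr_ge0 (_ * phi m)).
    rewrite [X in 0 <= X](_ : _ = e * e ^+ m0 * (1 - phi m / 2)); last by field.
    by rewrite !mulr_ge0 //; lra.
  have : e * e ^+ m0 <= e * z by rewrite ler_wpM2l //; lra.
  have : 0 <= e * z * (2 - 3 * e) by rewrite !mulr_ge0 //; lra.
  nra.
have {}uS := uS mm.
have phiE k : (m0 <= k)%N -> phi k = 2^-1 ^+ (k - m0).
  by move=> ?; rewrite /phi (_ : m0 - k = 0)%N;
    [rewrite expr0; ring|apply/eqP; rewrite subn_eq0].
rewrite (phiE m.+1) ?(phiE m) //; last by clear -mm; lia.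
rewrite subSn // exprS.
(* From [m0] on, a step down loses at most y = 2^-(m-m0) and a step up gains y/2, which leaves q y/2
   - e y = q y/4. *)
have pred : phi m.-1 - 2^-1 ^+ (m - m0) <= 2^-1 ^+ (m - m0).
  move: mm; rewrite leq_eqVlt => /orP[/eqP <-|mm].
    rewrite subnn expr0 /phi (_ : m0.-1 - m0 = 0)%N; last by clear; lia.
    by rewrite expr0; have := em (m0 - m0.-1)%N; lra.
  rewrite phiE; last by clear -mm; lia.
  rewrite (_ : m - m0 = (m.-1 - m0).+1)%N; last by clear -mm; lia.
  by rewrite exprS; lra.
have y01 := hm (m - m0)%N; move: (2^-1 ^+ (m - m0)) y01 pred => y y01 pred.
have : u * (phi m.-1 - y) <= e * y.
  have : u * (phi m.-1 - y) <= u * y by rewrite ler_wpM2l //; lra.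
  have : u * y <= e * y by rewrite ler_wpM2r //; lra.
  lra.
rewrite /e; have : q / 8 * e ^+ m0 * y <= q / 8 * y.
  by rewrite -mulrA ler_wpM2l //; nra.
have : 0 < q * y by rewrite mulr_gt0 //; lra.
lra.
Qed.

End Drift.

(** * Iterations of the algorithm *)

Section Moves.
Context (R : realType) (V : finType) (G : sgraph V) (beta : R).
Implicit Types (S : colset V) (o : op V).

Lemma max_gain_neq0 S (A : {set op V}) :
  A != finset.set0 -> max_gain G beta S A != finset.set0.
Proof.
move=> /finset.set0Pn [a aA]; apply/finset.set0Pn.
case: (@arg_maxP _ _ _ a (mem A) (gain G beta S) aA) => o' o'A o'max.
by exists o'; rewrite inE; apply/andP; split=> //; apply/forall_inP.
Qed.

Lemma card_verts_insertion o S : o \in insertions G S ->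
  #|verts (exec o S)| = #|verts S|.+1.
Proof.
rewrite inE; case: o => // x c /andP[xS _].
have -> : verts (exec (VertexInsert x c) S) = x |: verts S.
  by apply/finset.setP => y; rewrite !inE ffunE /=; case: (y =P x).
by rewrite cardsU1 xS.
Qed.

Lemma card_verts_flip o S : o \in flips S -> #|verts (exec o S)| = #|verts S|.
Proof.
rewrite inE; case: o => // x xS; apply: eq_card => y.
by rewrite !inE ffunE /=; case: (y =P x) => // ->; case: (S x).
Qed.

(** [connected_in] rejects the empty set, so a deletion never empties S. *)
Lemma card_verts_deletion o S : o \in deletions G S ->
  #|verts (exec o S)| = #|verts S|.-1 /\ (0 < #|verts (exec o S)|)%N.
Proof.
rewrite inE; case: o => // x /andP[xS conn].
have -> : verts (exec (VertexDelete x) S) = verts S :\ x.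
  by apply/finset.setP => y; rewrite !inE ffunE /=; case: (y =P x).
split; first by rewrite (cardsD1 x (verts S)) xS.
by rewrite card_gt0; case/andP: conn.
Qed.

Context (tb : tie_rule V).
Hypothesis tbP : valid_tie_rule tb.
Implicit Types (x : config R V) (b : bool * bool).

Lemma top_mem x (A : {set op V}) o : top G beta tb x A = Some o -> o \in A.
Proof.
rewrite /top; case: ifPn => // A0 [<-].
have /tbP : max_gain G beta (cur x) A != finset.set0 by exact: max_gain_neq0.
by move=> /(_ (cur x :: past x)); rewrite inE => /andP[].
Qed.

Lemma select_mem x b o : select G beta tb x b = Some o ->
  [\/ o \in insertions G (cur x), b.1 /\ o \in flips (cur x)
    | b.2 /\ o \in deletions G (cur x)].
Proof.
rewrite /select; case E : (top _ _ _ _ _) => [a0|] //= [<-].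
have o0I := top_mem E; case: b => b1 b2 /=.
set o1 := if b1 then _ else _.
have o1P : o1 \in insertions G (cur x) \/ b1 /\ o1 \in flips (cur x).
  rewrite /o1; clear o1; case: b1 => /=; last by left.
  rewrite /improve; case F : top => [a'|]; last by left.
  by case: ifP => _; [right; split=> //; exact: top_mem F|left].
have {}o1P : [\/ o1 \in insertions G (cur x), b1 /\ o1 \in flips (cur x)
    | b2 /\ o1 \in deletions G (cur x)].
  by case: o1P; [constructor 1|constructor 2].
clearbody o1; case: b2 o1P => //= o1P.
rewrite /improve; case F : top => [a'|] //.
by case: ifP => // _; constructor 3; split=> //; exact: top_mem F.
Qed.

(** The coins alone bound the new size from below, whatever the gains and the ties; this reduces the
    run to a walk on |S| with explicit step probabilities. *)
Lemma card_verts_select_ge x b o : select G beta tb x b = Some o ->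
  ((if b.2 then #|verts (cur x)|.-1
    else if b.1 then #|verts (cur x)| else #|verts (cur x)|.+1)
    <= #|verts (exec o (cur x))|)%N.
Proof.
move=> /select_mem /= [/card_verts_insertion ->|[-> /card_verts_flip ->]
  |[-> /card_verts_deletion [-> _]]] //; case: b => [[] []] /=; lia.
Qed.

Lemma card_verts_select_le x b o : select G beta tb x b = Some o ->
  (#|verts (exec o (cur x))| <= #|verts (cur x)|.+1)%N.
Proof.
by move=> /select_mem [/card_verts_insertion ->|[_ /card_verts_flip ->]
  |[_ /card_verts_deletion [-> _]]] //; lia.
Qed.

Lemma card_verts_select_gt0 x b o : select G beta tb x b = Some o ->
  (0 < #|verts (cur x)|)%N -> (0 < #|verts (exec o (cur x))|)%N.
Proof.
by move=> /select_mem [/card_verts_insertion ->|[_ /card_verts_flip ->]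
  |[_ /card_verts_deletion [_ ->]]].
Qed.

End Moves.

Lemma card_verts_start (V : finType) (s : V) : #|verts (start s)| = 1%N.
Proof.
rewrite (eq_card (B := pred1 s)) ?card1 // => y; rewrite !inE ffunE.
by case: (y =P s).
Qed.

(** * Bookkeeping along a run: history, termination, last improvement *)

Section Run.
Context (R : realType) (V : finType) (G : sgraph V) (beta : R) (s : V).
Context (T : nat) (K : R) (tb : tie_rule V).
Implicit Types (x : config R V) (b : bool * bool) (w : nat -> bool * bool).

Local Notation run := (run G beta s T K tb).
Local Notation iterate := (iterate G beta T K tb).
Local Notation iterations := (iterations G beta s T K tb).

Lemma run_ext w w' k : (forall i, (i < k)%N -> w i = w' i) ->
  run w k = run w' k.
Proof.
elim: k => //= k IH ww'; rewrite ww' // IH // => i ik.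
by rewrite ww' // ltnW.
Qed.

Lemma run_halted w k k' : (k <= k')%N -> ~~ running (run w k) ->
  run w k' = run w k.
Proof.
move=> /subnKC <- halt; elim: (k' - k)%N => [|i IH]; first by rewrite addn0.
by rewrite addnS /= IH /Defs.iterate halt.
Qed.

Lemma iterations_halted w : ~~ running (run w (iterations w)).
Proof. by rewrite /Defs.iterations; case: ex_minnP. Qed.

Lemma running_before_iterations w i : (i < iterations w)%N -> running (run w i).
Proof.
rewrite /Defs.iterations; case: ex_minnP => k _ kmin ik.
by apply: contraLR ik => /kmin; rewrite -leqNgt.
Qed.

(** Reads the number of iterations off the configuration: each one pushes a colouring on [past],
    except one that finds MH_I empty and sets [stuck]. *)
Definition executed x : nat := (size (past x) + stuck x)%N.

Lemma running_size_past w k : running (run w k) -> size (past (run w k)) = k.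
Proof.
elim: k => //= k IH; rewrite /Defs.iterate.
case: ifPn => [/negP nr r|/negPn r]; first by case: nr.
by case: select => [a|] _ //=; rewrite (IH r).
Qed.

Lemma executed_run w k : (k <= iterations w)%N -> executed (run w k) = k.
Proof.
case: k => [|k] // ki; have r := running_before_iterations ki.
rewrite /executed /= /Defs.iterate r /=; have := running_size_past r.
by case: select => [a|] /= ->; rewrite ?addn0 ?addn1.
Qed.

Lemma phi_cur_run w k :
  phi_cur (run w k) = value G beta (cur (run w k)) - value G beta (start s).
Proof.
elim: k => [|k IH] /=; first by rewrite subrr.
rewrite /Defs.iterate; case: ifP => // _; case: select => [a|] //=.
by rewrite IH /gain; ring.
Qed.

Lemma tau_ge w k : -1 <= tau (run w k).
Proof.
elim: k => [|k IH] //=.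
rewrite /Defs.iterate; case: ifPn => // /negPn /and3P[_ t0 _].
by case: select => [a|] //=; case: ifP => _; lia.
Qed.

(* Each iteration either lowers tau by one or raises phi_opt, hence removes a
   colouring from those that beat it, at the price of T units of tau. *)
Lemma iterations_bounded :
  exists N : nat, forall w, (iterations w <= N)%N.
Proof.
pose beat (a : R) :=
  #|[pred S : colset V | a < value G beta S - value G beta (start s)]|.
(* The factor T + 1 pays for the T units added to [tau] and for one more, so [pot] drops by at least
   1 with each executed operation. *)
pose pot x : int := (beat (phi_opt x) * T.+1)%:Z + tau x.
have step w k : running (run w k) ->
    pot (run w k) + k%:Z <= pot (init G s T K).
  elim: k => [_|k IH]; first by rewrite addr0.
  have [r|nr] := boolP (running (run w k)); last first.
    by rewrite /= /Defs.iterate nr => r; rewrite r in nr.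
  have := phi_cur_run w k.+1; rewrite /= /Defs.iterate r /=.
  case: select => [a|] //= phiE _; apply: le_trans (IH r); rewrite /pot /=.
  case: ltP => [lt|_] /=; last by clear; lia.
  move: lt phiE; set v := phi_cur _ + _ => lt phiE.
  suff : (beat v < beat (phi_opt (run w k)))%N.
    move: (beat _) (beat _) (tau _) => i j l; clear; nia.
  apply: proper_card; apply/properP; split.
    by apply/fintype.subsetP => S; rewrite !inE /=; apply: lt_trans.
  exists (exec a (cur (run w k))); rewrite !inE -?phiE //=.
  by rewrite ltxx.
(* While the loop runs, tau >= 0 and hence [pot] is nonnegative, so the initial [pot] bounds the
   number of iterations. *)
set c := pot (init G s T K) in step *; exists `|c|.+1 => w.
case E : (iterations w) => [|t] //.
have r : running (run w t) by apply: running_before_iterations; rewrite E.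
have := step w t r; clearbody c; rewrite /pot.
case/and3P: r => _ + _; move: (tau _) (beat _ * _)%N => a b; clear; lia.
Qed.

Lemma final_run w N : (iterations w <= N)%N ->
  final G beta s T K tb w = run w N.
Proof. by move=> tN; rewrite /final (run_halted tN) ?iterations_halted. Qed.

Lemma executed_final w N : (iterations w <= N)%N ->
  executed (run w N) = iterations w.
Proof. by move=> tN; rewrite -(final_run tN) executed_run. Qed.

(** Here j is the time of the last improvement of [phi_opt], or 0. The sum of [tau] and the number
    of operations is unchanged by a non-improving operation and grows by T + 1 with an improving
    one, of which there are at most j. *)
Lemma returned_run w k : let x := run w k in exists j : nat,
  [/\ nth (cur x) (cur x :: past x) (undoable x) = cur (run w j),
      size (past (run w j)) = j, (j <= size (past x))%N,
      (undoable x <= size (past x))%N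
    & tau x + (size (past x))%:Z <= T%:Z + (T.+1 * j)%:Z].
Proof.
elim: k => [|k [j [nthE sz jp up bound]]] /=.
  by exists 0%N; split=> //=; lia.
rewrite /Defs.iterate; case: ifPn => [_|/negPn r]; first by exists j.
case E : select => [a|] /=; last by exists j.
have skp := running_size_past r.
case: ifPn => better /=; last first.
  exists j; split=> //; [|lia|lia].
  (* The new head shifts the history by one, as does [undoable]; only the default of [nth] differs,
     and the index is in range. *)
  rewrite -nthE; apply: set_nth_default; rewrite /=; lia.
exists k.+1; rewrite /= /Defs.iterate r E /=.
rewrite skp in jp up bound *; split=> //.
have : (T.+1 * j <= T.+1 * k)%N by rewrite leq_mul.
rewrite mulnS; move: bound; move: (tau _) (_ * _)%N (_ * _)%N => x y z.
by clear; lia.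
Qed.

Hypothesis tbP : valid_tie_rule tb.

Lemma verts_run_gt0 w k : (0 < #|verts (cur (run w k))|)%N.
Proof.
elim: k => [|k IH] /=.
  by rewrite card_verts_start.
rewrite /Defs.iterate; case: ifP => // _; case E : select => [a|] //=.
exact: card_verts_select_gt0 E _.
Qed.

Lemma card_verts_run w k :
  (#|verts (cur (run w k))| <= (size (past (run w k))).+1)%N.
Proof.
elim: k => [|k IH] /=.
  by rewrite card_verts_start.
rewrite /Defs.iterate; case: ifP => // _; case E : select => [a|] //=.
by apply: leq_trans (card_verts_select_le tbP E) _.
Qed.

(** At the end tau >= -1, and a last stuck iteration adds 1, so [returned_run] gives t <= T + 2 + (T
    + 1) j. *)
Lemma returned_sizeP w : exists j : nat,
  [/\ returned_size G beta s T K tb w = #|verts (cur (run w j))|,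
      size (past (run w j)) = j, (j <= iterations w)%N
    & (iterations w <= T.+2 * j.+1)%N].
Proof.
have [j [nthE sz jp up bound]] := returned_run w (iterations w).
have := executed_final (leqnn (iterations w)); rewrite /executed => ex.
exists j; split=> //; first by rewrite /returned_size /returned /final nthE.
  by rewrite -ex (leq_trans jp) ?leq_addr.
rewrite -ex; have := tau_ge w (iterations w); move: bound.
move: (tau _) (size _) (stuck _) => a b c; clear; case: c => /=; nia.
Qed.

Lemma undoable_le w :
  (undoable (final G beta s T K tb w) <= iterations w)%N.
Proof.
have [j [_ _ _ up _]] := returned_run w (iterations w).
apply: leq_trans up _; rewrite -[leqRHS](executed_final (leqnn _)).
exact: leq_addr.
Qed.

Lemma returned_size_le w :
  (returned_size G beta s T K tb w <= (iterations w).+1)%N.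
Proof.
have [j [-> sz ji _]] := returned_sizeP w.
by rewrite (leq_trans (card_verts_run w j)) // sz ltnS.
Qed.

End Run.

(** * The law of the run *)

Section FiniteRange.
Context (R : realType) d (Omega : measurableType d) (P : probability Omega R).
Context (U : choiceType) (X : Omega -> U) (s : seq U).
Hypotheses (us : uniq s) (Xs : forall omega, X omega \in s).
Hypothesis mX : forall u, measurable [set omega | X omega = u].

(** [U] carries no sigma-algebra: with a finite range, measurable fibres suffice. *)
Lemma measurable_finite_range (A : pred U) :
  measurable [set omega | A (X omega)].
Proof.
rewrite (_ : mkset _ = \big[setU/set0]_(u <- s | A u) [set omega | X omega = u]).
  exact: bigsetU_measurable.
rewrite -bigcup_seq_cond; apply/seteqP.
split=> omega /= => [AX|[u /= /andP[_ Au] ->]//].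
by exists (X omega) => //=; rewrite Xs.
Qed.

Lemma expectation_finite_range (g : U -> R) : (forall u, 0 <= g u) ->
  ('E_P[g \o X] = \sum_(u <- s) (g u)%:E * P [set omega | X omega = u])%E.
Proof.
move=> g0; rewrite unlock.
transitivity (\int[P]_omega
    (\sum_(u <- s) (g u * \1_[set omega | X omega = u] omega)%:E)%E)%E.
  apply: eq_integral => omega _ /=; rewrite sumEFin (bigD1_seq (X omega)) //=.
  rewrite indicE mem_set //= mulr1 big1 ?addr0 // => u uX.
  by rewrite indicE memNset ?mulr0 //= => e; rewrite e eqxx in uX.
rewrite ge0_integral_sum //.
- apply: eq_bigr => u _.
  under eq_integral do rewrite EFinM.
  rewrite ge0_integralZl_EFin //.
    by rewrite integral_indic // setIT.
  by apply/measurable_EFinP; exact: measurable_indic.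
- move=> u; apply/measurable_EFinP; apply: measurable_funM => //.
- by move=> u omega _; rewrite lee_fin mulr_ge0.
Qed.

End FiniteRange.

(** The coin sequences of length N. They grow on the right because the last coins drive the
    outermost [iterate] of [run]. *)
Fixpoint words (N : nat) : seq (seq (bool * bool)) :=
  if N is N'.+1 then
    [seq rcons u b | u <- words N', b <- enum {: bool * bool}]
  else [:: [::]].

Local Notation word u := (nth (false, false) u).

Lemma mem_words N u : (u \in words N) = (size u == N).
Proof.
elim: N u => [|N IH] u; first by rewrite inE; case: u.
case/lastP: u => [|u b] /=.
  by apply/allpairsP => -[[u b] [_ _ /(congr1 size)]]; rewrite size_rcons.
rewrite size_rcons eqSS -IH; apply/allpairsP/idP => [[[v c] /= [vN _]]|uN].
  by move=> /rcons_inj[-> _].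
by exists (u, b); rewrite /= uN mem_enum.
Qed.

Lemma uniq_words N : uniq (words N).
Proof.
elim: N => //= N IH; apply: allpairs_uniq => //; first exact: enum_uniq.
by move=> [u b] [v c] _ _ /= /rcons_inj[-> ->].
Qed.

(** * The chain of configurations and its means over coin words *)

Section Law.
Context (R : realType) (V : finType) (G : sgraph V) (beta : R) (s : V).
Context (T : nat) (K : R) (tb : tie_rule V) (p : R).
Hypothesis p01 : 0 < p < 1.
Implicit Types (x : config R V) (b : bool * bool) (F : config R V -> R).

Local Notation run := (run G beta s T K tb).
Local Notation iterate := (iterate G beta T K tb).
Local Notation coins_pr := (@coins_pr R V p).

Lemma coins_pr_ge0 x b : 0 <= coins_pr x b.
Proof.
have := ln_div_ge0 R #|verts (cur x)|; have := ln_div_le1 R #|verts (cur x)|.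
rewrite /Defs.coins_pr -mulrA; set u := ln _ / _ => u1 u0.
have [p0 p1] := andP p01.
have pu0 : 0 <= p * u by rewrite mulr_ge0 // ltW.
have pu1 : p * u <= 1 by rewrite mulr_ile1 // ltW.
by rewrite mulr_ge0 // bernoulli_pmf_ge0 ?pu0 ?pu1 ?ltW.
Qed.

(** The transition operator of the chain: the conditional mean of F after one more iteration from
    x. *)
Definition step F x : R := \sum_b coins_pr x b * F (iterate b x).

Lemma sum_coins x (f : bool * bool -> R) :
  let u := p * ln #|verts (cur x)|%:R / #|verts (cur x)|%:R in
  \sum_b coins_pr x b * f b
  = p * (u * f (true, true) + (1 - u) * f (true, false))
    + (1 - p) * (u * f (false, true) + (1 - u) * f (false, false)).
Proof.
move=> u; transitivity (\sum_(b1 : bool) \sum_(b2 : bool)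
    coins_pr x (b1, b2) * f (b1, b2)).
  by rewrite pair_bigA; apply: eq_bigr => -[].
by rewrite big_bool !big_bool /Defs.coins_pr /bernoulli_pmf /= -/u; ring.
Qed.

Lemma step_stopped F x : ~~ running x -> step F x = F x.
Proof.
move=> nr; rewrite /step /Defs.iterate nr sum_coins; ring.
Qed.

Lemma step_le F x (f : bool * bool -> R) :
  (forall b, F (iterate b x) <= f b) ->
  step F x <= \sum_b coins_pr x b * f b.
Proof. by move=> Ff; apply: ler_sum => b _; rewrite ler_wpM2l ?coins_pr_ge0. Qed.

(** The expectation of F after N iterations as a finite sum, free of any probability space. *)
Definition mean (N : nat) F : R := \sum_(u <- words N)
  (\prod_(i < N) coins_pr (run (word u) i) (word u i)) * F (run (word u) N).

(** The tower property: the sum over the last pair of coins is taken first. *)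
Lemma meanS N F : mean N.+1 F = mean N (step F).
Proof.
rewrite /mean /= big_allpairs_dep; apply: eq_big_seq => u.
rewrite mem_words => /eqP uN; rewrite big_enum /= mulr_sumr.
apply: eq_bigr => b _; rewrite big_ord_recr /= mulrA.
have wE i : (i < N)%N -> word (rcons u b) i = word u i.
  by move=> iN; rewrite nth_rcons uN iN.
rewrite (run_ext _ _ _ _ _ _ wE).
rewrite nth_rcons uN ltnn eqxx; congr (_ * _ * _).
apply: eq_bigr => i _; rewrite wE //; congr (coins_pr _ _).
by apply: run_ext => j ji; rewrite wE // (ltn_trans ji).
Qed.

Lemma mean_le N F F' : (forall w, F (run w N) <= F' (run w N)) ->
  mean N F <= mean N F'.
Proof.
move=> FF'; apply: ler_sum => u _; apply: ler_wpM2l => //.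
by apply: prodr_ge0 => i _; exact: coins_pr_ge0.
Qed.

Lemma mean_supermartingale N F :
  (forall x, step F x <= F x) -> mean N F <= F (init G s T K).
Proof.
move=> FS; elim: N => [|N IH].
  by rewrite /mean /= big_seq1 big_ord0 mul1r.
by rewrite meanS; apply: le_trans IH; apply: mean_le.
Qed.

Lemma meanZ N (a : R) F : mean N (fun x => a * F x) = a * mean N F.
Proof. by rewrite /mean mulr_sumr; apply: eq_bigr => u _; ring. Qed.

Lemma meanD N F F' : mean N (fun x => F x + F' x) = mean N F + mean N F'.
Proof. by rewrite /mean -big_split; apply: eq_bigr => u _; rewrite mulrDr. Qed.

Context d (Omega : measurableType d) (P : probability Omega R).
Context (cF cD : nat -> {RV P >-> bool}).
Hypothesis coinsP : search_coins G beta s T K tb p cF cD.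

Local Notation coins omega := (fun i : nat => (cF i omega, cD i omega)).

Let draw N omega := mkseq (coins omega) N.

Let draw_words N omega : draw N omega \in words N.
Proof. by rewrite mem_words size_mkseq. Qed.

Let drawP N u : size u = N ->
  [set omega | draw N omega = u]
  = [set omega | forall i, (i < N)%N -> (cF i omega, cD i omega) = word u i].
Proof.
move=> uN; apply/seteqP; split=> omega /= => [<- i iN|cu].
  by rewrite nth_mkseq.
apply: (@eq_from_nth _ (false, false)); rewrite size_mkseq // => i iN.
by rewrite nth_mkseq // cu.
Qed.

Let measurable_draw N u : measurable [set omega | draw N omega = u].
Proof.
have [/drawP ->|uN] := eqVneq (size u) N; last first.
  rewrite (_ : mkset _ = set0) //; apply/seteqP; split=> // omega /= du.
  by rewrite -du size_mkseq eqxx in uN.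
rewrite (_ : mkset _ = \bigcap_(i in `I_N)
    (cF i @^-1` [set (word u i).1] `&` cD i @^-1` [set (word u i).2])).
  apply: bigcap_measurableType => i _; apply: measurableI.
    by rewrite -[X in measurable X]setTI; exact: measurable_funP.
  by rewrite -[X in measurable X]setTI; exact: measurable_funP.
apply/seteqP; split=> omega /= h i iN.
  by rewrite /= -(h i iN).
by have [/= -> ->] := h i iN; case: (word u i).
Qed.

Let run_draw N omega k : (k <= N)%N ->
  run (coins omega) k = run (word (draw N omega)) k.
Proof.
by move=> kN; apply: run_ext => i ik; rewrite nth_mkseq // (leq_trans ik).
Qed.

Lemma measurable_run N (A : config R V -> bool) :
  measurable [set omega | A (run (coins omega) N)].
Proof.
rewrite (_ : mkset _ = [set omega | A (run (word (draw N omega)) N)]).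
  exact: (measurable_finite_range (draw_words N) (measurable_draw N)
    (fun u => A (run (word u) N))).
by apply/seteqP; split=> omega /=; rewrite (run_draw _ (leqnn N)).
Qed.

(** Transfers [mean] to the probability space: the run depends on finitely many coins, and
    [search_coins] gives the probability of each coin word. *)
Lemma expectation_run N F : (forall w, 0 <= F (run w N)) ->
  ('E_P[fun omega => F (run (coins omega) N)] = (mean N F)%:E)%E.
Proof.
move=> F0.
have -> : (fun omega => F (run (coins omega) N))
    = (fun u => F (run (word u) N)) \o draw N.
  by apply/funext => omega; rewrite /= (run_draw _ (leqnn N)).
rewrite (expectation_finite_range P (uniq_words N) (draw_words N)
  (measurable_draw N)) // /mean -sumEFin.
apply: eq_big_seq => u; rewrite mem_words => /eqP uN.
by rewrite (drawP uN) coinsP -EFinM mulrC.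
Qed.

Lemma probability_run N (A : config R V -> bool) :
  P [set omega | A (run (coins omega) N)] = (mean N (fun x => (A x)%:R))%:E.
Proof.
rewrite -expectation_run // -expectation_indic; last exact: measurable_run.
by congr ('E_P[_])%E; apply/funext => omega; rewrite indicE mem_setE.
Qed.

End Law.

(** * The size of S *)

Section Growth.
Context (R : realType) (V : finType) (G : sgraph V) (beta : R) (s : V).
Context (T : nat) (K : R) (tb : tie_rule V) (p : R).
Hypotheses (p01 : 0 < p < 1) (tbP : valid_tie_rule tb).
Context (phi : nat -> R) (rho : R).
Hypothesis rho01 : 0 < rho < 1.
Hypothesis phi_bounds : forall m, 2^-1 ^+ m <= phi m <= 2.
Hypothesis phi_decr : forall m, phi m.+1 <= phi m.
Hypothesis phi_drift : forall m, let u := p * ln m%:R / m%:R in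
  (1 - p) * (1 - u) * phi m.+1 + p * (1 - u) * phi m + u * phi m.-1
  <= rho * phi m.
Implicit Types (x : config R V).

(** The exponent counts executed operations, so a stuck iteration leaves the potential unchanged. *)
Definition potential x : R := phi #|verts (cur x)| / rho ^+ size (past x).

(** As [phi] decreases, the least size allowed by each outcome of the coins gives an upper bound;
    [phi_drift] contracts its mean by rho, which the extra factor 1/rho cancels. *)
Lemma step_potential x : step G beta T K tb p potential x <= potential x.
Proof.
have [rho0 _] := andP rho01.
have rhoV i : 0 <= (rho ^+ i)^-1 by rewrite invr_ge0 exprn_ge0 ?ltW.
have [r|nr] := boolP (running x); last by rewrite step_stopped.
have phi_homo : {homo phi : m n / (m <= n)%N >-> n <= m}.
  by apply: homo_leq => [//|m n k nm kn|//]; exact: le_trans kn nm.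
case E : (top G beta tb x (insertions G (cur x))) => [a|]; last first.
  rewrite (le_trans (step_le p01 (f := fun=> potential x) _)) //.
    by move=> b; rewrite /iterate r /= /select E.
  by rewrite sum_coins le_eqVlt; apply/orP; left; apply/eqP; ring.
set m := #|verts (cur x)|; set k := size (past x).
pose f (b : bool * bool) : R :=
  phi (if b.2 then m.-1 else if b.1 then m else m.+1) / rho ^+ k.+1.
rewrite (le_trans (step_le p01 (f := f) _)) //.
  move=> b; rewrite /iterate r /=.
  case S : (select G beta tb x b) => [a'|]; last by move: S; rewrite /select E.
  rewrite /potential /f /= -/k; apply: ler_wpM2r => //.
  by apply: phi_homo; have := card_verts_select_ge tbP S.
rewrite sum_coins /f /potential /= -/m -/k.
have := phi_drift m; rewrite /=; set u := p * _ / _ => drift.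
rewrite [leRHS](_ : _ = rho * phi m / rho ^+ k.+1); last first.
  by rewrite exprS; field; rewrite expf_neq0 ?gt_eqF.
apply: le_trans (_ : _ <= ((1 - p) * (1 - u) * phi m.+1 + p * (1 - u) * phi m
  + u * phi m.-1) / rho ^+ k.+1) _.
  by rewrite le_eqVlt; apply/orP; left; apply/eqP; ring.
exact: ler_wpM2r.
Qed.

(** The first conjunct keeps only the runs in which each of the j iterations executed an
    operation. *)
Definition slow (D j : nat) x : bool :=
  (size (past x) == j) && (D * #|verts (cur x)| < j)%N.

(** Markov's inequality: if D|S| < j, then phi(|S|) >= 2^-|S| >= sigma^(D|S|) >= sigma^j, so
    (rho/sigma)^j times the potential is at least 1, while the initial potential is at most 2. *)
Lemma mean_slow (sigma : R) (D j : nat) : 0 < sigma < 1 ->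
  sigma ^+ D <= 2^-1 ->
  mean G beta s T K tb p j (fun x => (slow D j x)%:R)
  <= 2 * (rho / sigma) ^+ j.
Proof.
move=> /andP[sg0 sg1] sgD; have [rho0 _] := andP rho01.
have eta0 : 0 <= (rho / sigma) ^+ j by rewrite exprn_ge0 // divr_ge0 // ltW.
apply: le_trans (_ : _ <= mean G beta s T K tb p j
    (fun x => (rho / sigma) ^+ j * potential x)) _.
  apply: (mean_le p01) => w; move: (run _ _ _ _ _ _ _ _) => x.
  have [phi1 _] := andP (phi_bounds #|verts (cur x)|).
  have phi0 : 0 <= phi #|verts (cur x)| by rewrite (le_trans _ phi1) ?exprn_ge0.
  have pot0 : 0 <= (rho / sigma) ^+ j * potential x.
    by rewrite mulr_ge0 // divr_ge0 // exprn_ge0 // ltW.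
  rewrite /slow; case: eqP => [sz|_] //=; case: ltnP => [Dj|_] //=.
  rewrite /potential sz.
  rewrite [leRHS](_ : _ = phi #|verts (cur x)| / sigma ^+ j); last first.
    by rewrite expr_div_n; field; rewrite !expf_neq0 ?gt_eqF.
  rewrite ler_pdivlMr ?exprn_gt0 // mul1r; apply: le_trans phi1.
  apply: le_trans (_ : (sigma ^+ D) ^+ #|verts (cur x)| <= _); last first.
    by apply: lerXn2r; rewrite ?nnegrE ?exprn_ge0 // ltW.
  by rewrite -exprM; apply: ler_wiXn2l; [exact: ltW|exact: ltW|exact: ltnW].
rewrite meanZ mulrC ler_wpM2r //.
rewrite (le_trans (mean_supermartingale s p01 j step_potential)) //.
by rewrite /potential expr0 divr1; case/andP: (phi_bounds #|verts (start s)|).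
Qed.

End Growth.

(** * Estimates for the union bound *)

Lemma geometric_tail_le (R : realFieldType) (eta : R) (L M : nat) :
  0 <= eta < 1 ->
  \sum_(i < M) (if (L <= i)%N then eta ^+ i else 0) <= eta ^+ L / (1 - eta).
Proof.
move=> /andP[e0 e1]; rewrite ler_pdivlMr ?subr_gt0 //.
(* A telescoping invariant: the term eta^max(L,M) stands for the part of the tail not yet summed. *)
suff : (\sum_(i < M) (if (L <= i)%N then eta ^+ i else 0)) * (1 - eta)
    + eta ^+ maxn L M <= eta ^+ L.
  by have := exprn_ge0 (maxn L M) e0; lra.
elim: M => [|M IH]; first by rewrite big_ord0 mul0r add0r maxn0.
rewrite big_ord_recr /=; case: leqP => LM.
  rewrite (maxn_idPr (leqW LM)); rewrite (maxn_idPr LM) in IH.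
  by apply: le_trans IH; rewrite exprS le_eqVlt; apply/orP; left; apply/eqP; ring.
rewrite (maxn_idPl LM); rewrite (maxn_idPl (ltnW LM)) in IH.
by rewrite addr0.
Qed.

Lemma exprn_small (R : realType) (x e : R) : 0 < x < 1 -> 0 < e ->
  exists D : nat, x ^+ D <= e.
Proof.
move=> /andP[x0 x1] e0.
have l0 : ln x < 0 by rewrite ln_lt0 // x0.
have [D DP] : exists D : nat, ln e / ln x <= D%:R.
  exists (Num.truncn (ln e / ln x)).+1; apply: ltW; exact: truncnS_gt.
exists D; rewrite -ler_ln ?posrE ?exprn_gt0 // lnXn // -mulr_natl.
by rewrite -ler_ndivrMr.
Qed.

Lemma tail_le_powR (R : realType) (eta c : R) : 0 < eta < 1 -> 0 < c ->
  exists2 A : R, 0 < A & forall n L : nat, (1 < n)%N -> A * ln n%:R <= L%:R ->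
    2 * (eta ^+ L / (1 - eta)) <= n%:R `^ (- c).
Proof.
move=> /andP[e0 e1] c0.
have l0 : 0 < - ln eta by rewrite oppr_gt0 ln_lt0 // e0.
have l2 : 0 < ln 2 :> R by rewrite ln_gt0 // ltr1n.
have k1 : 1 < 2 / (1 - eta) by rewrite ltr_pdivlMr ?subr_gt0 //; lra.
have k0 : 0 < ln (2 / (1 - eta)) by rewrite ln_gt0.
(* After taking logarithms the constant k = ln(2/(1-eta)) remains; as n >= 2, it is at most (k / ln
   2) ln n. *)
exists ((c + ln (2 / (1 - eta)) / ln 2) / - ln eta).
  by rewrite divr_gt0 // addr_gt0 // divr_gt0.
move=> n L n1 AL; have n0 : 0 < n%:R :> R by rewrite ltr0n ltnW.
have ln2n : ln 2 <= ln n%:R :> R by rewrite ler_ln ?posrE // ler_nat.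
rewrite -ler_ln ?posrE ?powR_gt0 ?mulr_gt0 ?exprn_gt0 ?invr_gt0 ?subr_gt0 //.
rewrite ln_powR (_ : 2 * _ = 2 / (1 - eta) * eta ^+ L); last by ring.
rewrite lnM ?posrE ?exprn_gt0 ?divr_gt0 ?subr_gt0 // lnXn //.
rewrite -[ln eta *+ L]mulr_natl.
move: AL; rewrite mulrAC ler_pdivrMr // mulrDl.
have : ln (2 / (1 - eta)) <= ln (2 / (1 - eta)) / ln 2 * ln n%:R.
  by rewrite -mulrA ler_peMr ?(ltW k0) // mulrC ler_pdivlMr // mul1r.
move: (ln (2 / _)) => k; lra.
Qed.

(** * The cost *)

Section Cost.
Context (R : realType) (V : finType) (G : sgraph V) (beta : R) (s : V).
Context (T : nat) (K : R) (tb : tie_rule V) (p : R).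
Hypotheses (p01 : 0 < p < 1) (K0 : 0 < K).
Implicit Types (x : config R V).

Local Notation l := (ln #|V|%:R : R).
Local Notation Delta := ((max_degree G)%:R : R).

Lemma card_nbrs_le y : (#|y |: nbrs G y| <= (max_degree G).+1)%N.
Proof.
rewrite cardsU1 -add1n leq_add ?leq_b1 //.
exact: (leq_bigmax (F := fun y => #|nbrs G y|)).
Qed.

Lemma card_gt1_max_degree : (0 < max_degree G)%N -> (1 < #|V|)%N.
Proof.
move=> D0; rewrite ltnNge; apply/negP => V1.
suff : max_degree G = 0%N by move: D0 => /[swap] ->.
apply: big1 => y _; apply: eq_card0 => z; rewrite !inE.
have -> : z = y by apply: (fintype_le1P V1).
by rewrite /adj epos_irr eneg_irr.
Qed.

Lemma ln_card_ge0 : 0 <= l.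
Proof. by rewrite ln_ge0 // ler1n; apply/card_gt0P; exists s. Qed.

Lemma cost_nbrs_le y : 0 <= #|y |: nbrs G y|%:R * l <= (Delta + 1) * l.
Proof.
rewrite mulr_ge0 ?ln_card_ge0 // ler_wpM2r ?ln_card_ge0 //.
by rewrite natr1 ler_nat card_nbrs_le.
Qed.

Lemma iter_cost_ge0 x b o : 0 <= iter_cost G K x b o.
Proof.
have /andP[c0 _] := cost_nbrs_le (op_vertex o).
rewrite /iter_cost mulr_ge0 ?(ltW K0) // addr_ge0 // addr_ge0 //.
by case: ifP.
Qed.

Lemma time_run_ge0 w k : 0 <= time (run G beta s T K tb w k).
Proof.
elim: k => [|k IH] /=.
  have /andP[c0 _] := cost_nbrs_le s.
  by rewrite mulr_ge0 ?(ltW K0) // addr_ge0.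
rewrite /iterate; case: ifP => // _; case: select => [a|] /=.
  by rewrite addr_ge0 // iter_cost_ge0.
by rewrite addr_ge0 // (ltW K0).
Qed.

(** Time beyond the initialization and a fixed allowance per iteration: bookkeeping, the mean cost
    of DelEval, and the heap updates. It vanishes at the start. *)
Definition overrun x : R :=
  time x - K * (1 + #|s |: nbrs G s|%:R * l)
  - K * (1 + Delta * l + (Delta + 1) * l) * (executed x)%:R.

(* DelEval costs Delta |S| with probability p ln|S| / |S|, that is, at most
   Delta ln n in mean. *)
Lemma step_overrun x : step G beta T K tb p overrun x <= overrun x.
Proof.
have [r|nr] := boolP (running x); last by rewrite step_stopped.
have l0 := ln_card_ge0; have [p0 p1] := andP p01.
pose m : R := #|verts (cur x)|%:R.
(* The allowance covers all but DelEval for every outcome of the coins; what remains is DelEval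
   minus its mean allowance. *)
pose f (b : bool * bool) : R :=
  overrun x + K * ((if b.2 then Delta * m else 0) - Delta * l).
apply: le_trans (step_le p01 (f := f) _) _ => [b|].
  have st : stuck x = false by case/and3P: r => /negbTE.
  have nl y : #|y |: nbrs G y|%:R * l <= (Delta + 1) * l.
    by case/andP: (cost_nbrs_le y).
  have D0 : 0 <= Delta by [].
  rewrite /iterate r /f /overrun /executed /iter_cost st /= !addn0.
  have em (y : bool) : (if y then (max_degree G * #|verts (cur x)|)%:R else 0)
      = if y then Delta * m else 0 by rewrite natrM.
  move: (nl) D0; set c := K * (1 + #|_|%:R * l); set k := size (past x).
  set D := Delta in em *; set L := l in l0 *.
  have el : 0 <= D -> 0 <= if b.2 then D * m else 0.
    by move=> D0; case: ifP => // _; rewrite mulr_ge0.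
  case: select => [a|] {}nl D0 /=; rewrite ?addn0 ?addn1 -natr1.
    rewrite em; move: (nl (op_vertex a)); set e := #|_ |: _|%:R * L.
    move: {em el} (if _ then _ else _) (time x) k%:R => d t k' eL.
    clearbody c D L e.
    have : 0 <= K * ((D + 1) * L - e) by rewrite mulr_ge0 ?(ltW K0) ?subr_ge0.
    lra.
  move: {em} (if _ then _ else _) (time x) k%:R (el D0) => d t k' d0.
  clearbody c D L.
  have : 0 <= K * ((D + 1) * L + d).
    by rewrite mulr_ge0 ?(ltW K0) ?addr_ge0 ?mulr_ge0 ?addr_ge0.
  lra.
rewrite sum_coins /f /= -/m; set u := p * _ / m.
have um : u * m <= l.
  rewrite /u; have [m0|m0] := eqVneq m 0; first by rewrite m0 mulr0.
  rewrite divfK //; apply: le_trans (_ : ln m <= l).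
    apply: ler_piMl; last exact: ltW.
    by rewrite ln_ge0 // ler1n lt0n -(eqr_nat R).
  have mp : 0 < m by rewrite lt_neqAle eq_sym m0 ler0n.
  rewrite ler_ln ?posrE //; first by rewrite ler_nat max_card.
  by apply: lt_le_trans mp _; rewrite ler_nat max_card.
have : K * Delta * (u * m) <= K * Delta * l.
  by rewrite ler_wpM2l // mulr_ge0 // ltW.
lra.
Qed.

(** The running time as a function of the final configuration, the form that [expectation_run]
    takes. *)
Definition total_cost x : R :=
  time x + K * ((undoable x)%:R * (1 + (max_degree G).+1%:R * l)
    + ((max_degree G).+1
       * #|verts (nth (cur x) (cur x :: past x) (undoable x))|)%:R).

Lemma running_timeE w :
  running_time G beta s T K tb w = total_cost (final G beta s T K tb w).
Proof. by []. Qed.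

(** An edge forces n >= 2, hence t >= 1 and ln n >= ln 2; the undo phase has at most t operations
    and the output at most t + 1 vertices. *)
Lemma total_cost_le (w : nat -> bool * bool) : valid_tie_rule tb ->
  (0 < max_degree G)%N ->
  total_cost (final G beta s T K tb w) <= overrun (final G beta s T K tb w)
    + 7 * K * (1 + (ln 2)^-1) * Delta * l
      * (executed (final G beta s T K tb w))%:R.
Proof.
move=> tbP D0; set x := final _ _ _ _ _ _ _; have V1 := card_gt1_max_degree D0.
have t0 : (0 < iterations G beta s T K tb w)%N.
  rewrite lt0n; apply/eqP => t0; have := iterations_halted G beta s T K tb w.
  by rewrite t0 /running /= card_verts_start V1.
have xE : executed x = iterations G beta s T K tb w by exact: executed_run.
have ux := undoable_le G beta s T K tb w.
have hx := returned_size_le G beta s T K tbP w.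
have /andP[_ sx] := cost_nbrs_le s.
rewrite /total_cost /overrun -/(returned_size G beta s T K tb w) xE.
move: (iterations _ _ _ _ _ _ _) t0 ux hx => t t0.
rewrite -/x; move: (undoable x) (returned_size _ _ _ _ _ _ _) => u h.
rewrite -!(ler_nat R) natrM -[t.+1%:R]natr1 -[(max_degree G).+1%:R]natr1 => ux hx.
have t1 : 1 <= t%:R :> R by rewrite ler1n.
have D1 : 1 <= Delta by rewrite ler1n.
have l2 : 0 < ln 2 :> R by rewrite ln_gt0 // ltr1n.
have ll2 : 1 <= l / ln 2.
  by rewrite ler_pdivlMr // mul1r ler_ln ?posrE ?ltr0n ?ler_nat // ltnW.
have l0 : 0 <= l := ln_card_ge0.
move: #|s |: _|%:R sx => ds sx.
clear t0; move: (t%:R) (u%:R) (h%:R) ux hx t1 => {}t {}u {}h ut ht t1.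
move: Delta D1 sx => D D1 sx; move: l ll2 l0 sx => L ll2 l0 sx.
have Dl : D * L <= D * L * t by rewrite ler_peMr // mulr_ge0 //; lra.
(* Since D, t and y are at least 1, the terms without logarithm add up to at most 7 D t y, and those
   with one to at most 7 D t L. *)
pose y := L / ln 2; have yE : (ln 2)^-1 * L = y by rewrite mulrC.
have -> : 7 * K * (1 + (ln 2)^-1) * D * L * t = K * (7 * (D * t) * (L + y)).
  by rewrite -yE; ring.
rewrite -subr_ge0.
set rhs := (X in 0 <= X).
have -> : rhs = K * (7 * (D * t) * (L + y) - (1 + ds * L)
  - (1 + D * L + (D + 1) * L) * t - u * (1 + (D + 1) * L) - (D + 1) * h).
  by rewrite /rhs; ring.
rewrite mulr_ge0 ?(ltW K0) //.
have y1 : 1 <= y by [].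
clearbody y; clear rhs yE ll2.
have Dt : t <= D * t by rewrite ler_peMl //; lra.
have Lt : L * t <= L * (D * t) by rewrite ler_wpM2l.
have uu : u * (1 + (D + 1) * L) <= t * (1 + (D + 1) * L).
  by rewrite ler_wpM2r // addr_ge0 // mulr_ge0 //; lra.
have hh : (D + 1) * h <= (D + 1) * (t + 1) by rewrite ler_wpM2l //; lra.
have DD : D <= D * t by rewrite ler_peMr //; lra.
have yy : D * t <= D * t * y by rewrite ler_peMr //; lra.
have LL : L <= L * t by rewrite ler_peMr.
lra.
Qed.

End Cost.

(** * The two bounds *)

(** Stated for every C >= C0, so that a single constant can serve both bounds. *)
Lemma search_size_whp (R : realType) (p : R) (T : nat) (K c : R) :
  0 < p < 1 -> 0 < c ->
  exists2 C0 : R, 0 < C0 &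
  forall (C : R) (V : finType) (G : sgraph V) (beta : R) (s : V)
    (tb : tie_rule V) (d : measure_display) (Omega : measurableType d)
    (P : probability Omega R) (cF cD : nat -> {RV P >-> bool}),
  C0 <= C -> valid_tie_rule tb -> search_coins G beta s T K tb p cF cD ->
  ((1 - #|V|%:R `^ (- c))%:E <= P [set omega |
    (C^-1 * ((iterations G beta s T K tb
                (fun i => (cF i omega, cD i omega)))%:R / ln #|V|%:R)
     <= (returned_size G beta s T K tb
           (fun i => (cF i omega, cD i omega)))%:R)%R])%E.
Proof.
move=> p01 c0.
have [phi [rho [rho01 phiB phiS drift]]] := drift_potential p01.
have [rho0 rho1] := andP rho01.
(* Any sigma strictly between rho and 1 makes eta = rho/sigma < 1; D is then chosen with sigma^D <=
   1/2. *)
pose sigma := (1 + rho) / 2; have sg01 : 0 < sigma < 1 by rewrite /sigma; lra.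
have [sg0 sg1] := andP sg01.
pose eta := rho / sigma; have eta01 : 0 < eta < 1.
  by rewrite divr_gt0 //= ltr_pdivrMr // mul1r /sigma; lra.
have [D sgD] : exists D : nat, sigma ^+ D <= 2^-1.
  by apply: exprn_small sg01 _; lra.
have [A A0 tail] := tail_le_powR eta01 c0.
have l2 : 0 < ln 2 :> R by rewrite ln_gt0 // ltr1n.
(* T + 2 converts j + 1 into t, A ln n covers the times j below L, and D + 1 the later ones that are
   not slow; 1/ln 2 turns a constant into a multiple of ln n. *)
pose C0 := T.+2%:R * (A + D.+1%:R / ln 2); exists C0.
  by rewrite mulr_gt0 ?ltr0Sn // addr_gt0 // divr_gt0 ?ltr0Sn.
move=> C V G beta s tb d Omega P cF cD C0C tbP coinsP.
have C0p : 0 < C0.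
  by rewrite mulr_gt0 ?ltr0Sn // addr_gt0 // divr_gt0 ?ltr0Sn.
have Cp : 0 < C by apply: lt_le_trans C0C.
(* For n = 1 the claimed probability is 1 - 1 = 0. *)
have [n1|n1] := leqP #|V| 1.
  have -> : #|V| = 1%N.
    by apply/eqP; rewrite eqn_leq n1; apply/card_gt0P; exists s.
  by rewrite powR1 subrr measure_ge0.
have [N NP] := iterations_bounded G beta s T K tb.
pose coins omega (i : nat) := (cF i omega, cD i omega).
pose run omega k := run G beta s T K tb (coins omega) k.
set l := ln #|V|%:R; have ll2 : 1 <= l / ln 2.
  rewrite ler_pdivlMr // mul1r ler_ln ?posrE ?ler_nat //.
  by rewrite ltr0n ltnW.
have l0 : 0 < l by rewrite ln_gt0 // ltr1n.
pose L := (Num.truncn (A * l)).+1.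
have AL : A * l <= L%:R by rewrite ltW // truncnS_gt.
have LA : L%:R <= A * l + 1.
  by rewrite -natr1 lerD2r truncn_le // mulr_ge0 // ltW.
pose ok (x : config R V) : bool := C^-1 * ((executed x)%:R / l)
  <= #|verts (nth (cur x) (cur x :: past x) (undoable x))|%:R.
(* Either j + 1 <= L <= A ln n + 1, or j <= D h and thus j + 1 <= (D + 1) h, as h >= 1. *)
have okP (t j h : nat) : (0 < h)%N -> (t <= T.+2 * j.+1)%N ->
    ~~ ((L <= j) && (D * h < j))%N -> C^-1 * (t%:R / l) <= h%:R.
  move=> h0 tj; rewrite negb_and -ltnNge -leqNgt => jDL.
  rewrite mulrC ler_pdivrMr // ler_pdivrMr //.
  apply: le_trans (_ : h%:R * C0 * l <= _); last first.
    by apply: ler_wpM2r; [exact: ltW|exact: ler_wpM2l].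
  have h1 : 1 <= h%:R :> R by rewrite ler1n.
  have {}tj : t%:R <= T.+2%:R * (j.+1%:R : R) by rewrite -natrM ler_nat.
  apply: (le_trans tj).
  have -> : h%:R * C0 * l = T.+2%:R * (h%:R * (A * l + D.+1%:R * (l / ln 2))).
    by rewrite /C0; field; rewrite gt_eqF.
  apply: ler_wpM2l => //.
  have Al : 0 <= A * l by rewrite mulr_ge0 ?ltW.
  have Dl : D.+1%:R <= D.+1%:R * (l / ln 2) by rewrite ler_peMr.
  apply: le_trans (_ : h%:R * (A * l + D.+1%:R) <= _); last first.
    by rewrite ler_wpM2l // lerD2l.
  case/orP: jDL => [jL|jD].
    apply: le_trans (_ : A * l + D.+1%:R <= _); last first.
      by rewrite ler_peMl // addr_ge0.
    apply: le_trans (_ : L%:R <= _); first by rewrite ler_nat.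
    by apply: (le_trans LA); rewrite lerD2l ler1n.
  apply: le_trans (_ : h%:R * D.+1%:R <= _); last first.
    by rewrite ler_wpM2l // lerDr.
  by rewrite -natrM ler_nat mulnS; apply: leq_ltn_trans jD _;
    rewrite mulnC -[X in (X < _)%N]add0n ltn_add2r.
rewrite (_ : mkset _ = ~` [set omega | ~~ ok (run omega N)]); last first.
  apply/seteqP; split=> omega /=; rewrite /ok /returned_size /returned;
    rewrite (final_run (NP (coins omega))) (executed_final (NP (coins omega)));
    by [move=> /[swap] /negP|move=> /negP; rewrite negbK].
have mrun k (B : config R V -> bool) : measurable [set omega | B (run omega k)].
  exact: (measurable_run G beta s T K tb).
rewrite probability_setC; last exact: (mrun N (fun x => ~~ ok x)).
rewrite EFinB leeB //.
pose bad j := [set omega | (L <= j)%N && slow D j (run omega j)].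
have mbad j : measurable (bad j) by exact: (mrun j (fun x => (L <= j)%N && _)).
(* The time j of the last improvement is random, hence the union over all j; the geometric tail
   makes the bound independent of N. *)
have sub : [set omega | ~~ ok (run omega N)]
    `<=` \big[setU/set0]_(j < N.+1) bad j.
  move=> omega /= nok; rewrite -bigcup_mkord.
  have [j [hE sz ji ti]] := returned_sizeP G beta s T K tb (coins omega).
  exists j; first by rewrite /= ltnS (leq_trans ji).
  rewrite /bad /= /slow /run sz eqxx /=; apply: contraNT nok => nb.
  rewrite /ok /run (executed_final (NP (coins omega))).
  move: hE; rewrite /returned_size /returned (final_run (NP (coins omega))) => ->.
  by apply: okP ti nb; exact: verts_run_gt0.
apply: le_trans (le_measure P _ _ sub) _; rewrite ?inE.
- exact: (mrun N (fun x => ~~ ok x)).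
- by apply: bigsetU_measurable.
apply: le_trans (Boole_inequality _ _) _ => //.
have Pbad j : (P (bad j) <= (2 * (if (L <= j)%N then eta ^+ j else 0))%:E)%E.
  rewrite /bad; case: ifP => Lj /=; last first.
    by rewrite (_ : mkset _ = set0) ?measure0 ?mulr0 //; apply/seteqP; split.
  rewrite (probability_run coinsP j (slow D j)) lee_fin.
  exact: (mean_slow G beta s T K p01 tbP rho01 phiB phiS drift j sg01 sgD).
apply: (@le_trans _ _ (\sum_(j < N.+1)
    (2 * (if (L <= j)%N then eta ^+ j else 0))%:E)%E).
  by apply: lee_sum => j _; exact: Pbad.
rewrite sumEFin lee_fin -mulr_sumr.
apply: le_trans (tail #|V| L n1 AL).
by rewrite ler_wpM2l // geometric_tail_le // ltW; case/andP: eta01.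
Qed.

(** [overrun] is a supermartingale that starts at 0, so its mean after N iterations is at most 0,
    where N bounds the length of every run; [total_cost_le] leaves a multiple of the mean of t. *)
Lemma search_expected_cost (R : realType) (p : R) (T : nat) (K : R)
    (V : finType) (G : sgraph V) (beta : R) (s : V) (tb : tie_rule V)
    (d : measure_display) (Omega : measurableType d) (P : probability Omega R)
    (cF cD : nat -> {RV P >-> bool}) :
  0 < p < 1 -> 0 < K -> valid_tie_rule tb ->
  search_coins G beta s T K tb p cF cD -> (0 < max_degree G)%N ->
  ('E_P[fun omega => running_time G beta s T K tb
          (fun i => (cF i omega, cD i omega))]
   <= (7 * K * (1 + (ln 2)^-1) * (max_degree G)%:R * ln #|V|%:R)%:E
      * 'E_P[fun omega => (iterations G beta s T K tb
               (fun i => (cF i omega, cD i omega)))%:R])%E.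
Proof.
move=> p01 K0 tbP coinsP D0.
have [N NP] := iterations_bounded G beta s T K tb.
pose cost := total_cost G K; set a := 7 * K * _ * _ * _.
have costE w : running_time G beta s T K tb w
    = cost (run G beta s T K tb w N).
  by rewrite running_timeE (final_run (NP w)).
under [X in ('E_P[X] <= _)%E]eq_fun do rewrite costE.
under [X in (_ <= _ * 'E_P[X])%E]eq_fun do rewrite -(executed_final (NP _)).
rewrite (expectation_run coinsP (N := N) (F := cost)); last first.
  move=> w; rewrite /cost /total_cost addr_ge0 ?(time_run_ge0 G beta s) //.
  by rewrite mulr_ge0 ?(ltW K0) // addr_ge0 // mulr_ge0 // addr_ge0 //
    mulr_ge0 // (ln_card_ge0 R s).
rewrite (expectation_run coinsP (N := N) (F := fun x => (executed x)%:R)) //.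
rewrite -EFinM lee_fin.
apply: le_trans (_ : mean G beta s T K tb p N
    (fun x => overrun G s K x + a * (executed x)%:R) <= _).
  apply: mean_le => // w; rewrite -(final_run (NP w)).
  exact: total_cost_le.
rewrite meanD meanZ gerDr; apply: le_trans (mean_supermartingale s p01 N _) _.
  exact: step_overrun.
by rewrite /overrun /executed /= mulr0 subr0 subrr.
Qed.

Theorem lemma4p4 (R : realType) (p : R) (T : nat) (K c : R)
    (p01 : 0 < p < 1) (T_gt0 : (0 < T)%N) (K_gt0 : 0 < K) (c_gt0 : 0 < c) :
  exists2 C : R, 0 < C &
  forall (V : finType) (G : sgraph V) (beta : R) (s : V) (tb : tie_rule V)
    (d : measure_display) (Omega : measurableType d) (P : probability Omega R)
    (cF cD : nat -> {RV P >-> bool}),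
  0 < beta <= 1 ->
  valid_tie_rule tb ->
  search_coins G beta s T K tb p cF cD ->
  let n : R := #|V|%:R in
  let coins (omega : Omega) (i : nat) := (cF i omega, cD i omega) in
  let t (omega : Omega) : R := (iterations G beta s T K tb (coins omega))%:R in
  let h (omega : Omega) : R := (returned_size G beta s T K tb (coins omega))%:R in
  let cost (omega : Omega) : R := running_time G beta s T K tb (coins omega) in
  ((1 - n `^ (- c))%:E <= P [set omega | (C^-1 * (t omega / ln n) <= h omega)%R])%E
  /\ ((0 < max_degree G)%N ->
      ('E_P[cost] <= (C * (max_degree G)%:R * ln n)%:E * 'E_P[t])%E).
Proof.
have [C0 C0p size_whp] := search_size_whp T K p01 c_gt0.
have l2 : 0 < ln 2 :> R by rewrite ln_gt0 // ltr1n.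
have C1p : 0 <= 7 * K * (1 + (ln 2)^-1).
  by rewrite !mulr_ge0 ?addr_ge0 ?invr_ge0 ?(ltW K_gt0) ?(ltW l2).
(* The sum dominates both constants, and each bound is monotone in the constant. *)
exists (C0 + 7 * K * (1 + (ln 2)^-1)); first by rewrite ltr_pwDl.
move=> V G beta s tb d Omega P cF cD _ tbP coinsP n coins t h cost.
split=> [|D0]; first by apply: size_whp => //; rewrite lerDl.
apply: le_trans (search_expected_cost p01 K_gt0 tbP coinsP D0) _.
apply: lee_wpmul2r; first by apply: expectation_ge0 => omega.
rewrite lee_fin ler_wpM2r ?(ln_card_ge0 R s) // ler_wpM2r //.
by rewrite lerDr ltW.
Qed.
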